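(* Let $\lambda_6\in\mathbb{R}$ and let $\lambda=(0,0,0,0,0,\lambda_6,\lambda_6,-\lambda_6)$ (a highest weight for $\mathfrak{e}_6$). (1) If $\lambda_6>2$, then $\lambda$ satisfies the strict Dirac inequality $\|(\lambda-s_{a,b})^{+}+\rho\|^2>\|\lambda+\rho\|^2$ for all $a,b\in\mathbb{N}_0$ with $a+b\neq 0$. (2) If $0<\lambda_6<2$, then $\|(\lambda-s_2)^{+}+\rho\|^2<\|\lambda+\rho\|^2$, and the strict Dirac inequality $\|(\lambda-s)^{+}+\rho\|^2>\|\lambda+\rho\|^2$ holds for any Schmid module $s$ of strictly lower level than $s_2$. (3) If $\lambda_6<0$, then the basic Dirac inequality fails, i.e. $\|(\lambda-s_1)^{+}+\rho\|^2<\|\lambda+\rho\|^2$.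
   Context: Setting for $\mathfrak{e}_6$ (Hermitian case). Work in $\mathbb{R}^8$ with the standard inner product $\langle\cdot,\cdot\rangle$ and norm $\|\cdot\|$, and let $\mathbb{N}_0=\{0,1,2,\dots\}$. Put $\rho=(0,1,2,3,4,-4,-4,4)$. The group $W_{\mathfrak{k}}$ is generated by the reflections $s_\alpha(\mu)=\mu-\frac{2\langle\mu,\alpha\rangle}{\langle\alpha,\alpha\rangle}\alpha$ for $\alpha=\varepsilon_i\pm\varepsilon_j$, $5\ge i>j\ge 1$, where $\varepsilon_i$ is the $i$-th coordinate functional, identified with the $i$-th standard basis vector; so $W_{\mathfrak{k}}$ permutes the first five coordinates and changes an even number of their signs. For $\mu\in\mathbb{R}^8$, $\mu^{+}$ denotes the unique $W_{\mathfrak{k}}$-conjugate of $\mu$ satisfying $|\mu_1|\le\mu_2\le\mu_3\le\mu_4\le\mu_5$. A highest weight is a real vector $\lambda=(\lambda_1,\lambda_2,\lambda_3,\lambda_4,\lambda_5,\lambda_6,\lambda_6,-\lambda_6)$ with $|\lambda_1|\le\lambda_2\le\lambda_3\le\lambda_4\le\lambda_5$ and $\lambda_i-\lambda_j\in\mathbb{Z}$, $2\lambda_i\in\mathbb{Z}$ for $i,j\in\{1,\dots,5\}$. The basic Schmid modules are (represented by) $s_1=\frac12(1,1,1,1,1,-1,-1,1)$ and $s_2=(0,0,0,0,1,-1,-1,1)$. A general Schmid module is $s_{a,b}=a s_1+b s_2$ with $a,b\in\mathbb{N}_0$, $a+b>0$; its level is $a+2b$. The Dirac inequality for a Schmid module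 $s$ is $\|(\lambda-s)^{+}+\rho\|^2\ge\|\lambda+\rho\|^2$; it is called strict if $>$ holds, and it is called the basic Dirac inequality when $s=s_1$. *)

(* Defs.v *)
From mathcomp Require Import all_boot all_order all_algebra.
From mathcomp Require Import boolp classical_sets reals.

Set Implicit Arguments.
Unset Strict Implicit.
Unset Printing Implicit Defensive.

Import Order.TTheory GRing.Theory Num.Theory.
Local Open Scope ring_scope.

(* Coordinates are numbered from 0: the mathematical mu_k is mu 0 (inord k.-1). *)
Definition vec8 (R : realType) (s : seq R) : 'rV[R]_8 := \row_(i < 8) s`_i.

Definition dot (R : realType) (u v : 'rV[R]_8) : R := \sum_(i < 8) u 0 i * v 0 i.

Definition enorm (R : realType) (u : 'rV[R]_8) : R := Num.sqrt (dot u u).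

Definition eps (R : realType) (i : 'I_8) : 'rV[R]_8 := delta_mx 0 i.

Definition rho (R : realType) : 'rV[R]_8 :=
  vec8 [:: 0; 1; 2; 3; 4; -4; -4; 4].

Definition reflection (R : realType) (alpha mu : 'rV[R]_8) : 'rV[R]_8 :=
  mu - (2 * dot mu alpha / dot alpha alpha) *: alpha.

(* alpha = eps_i + eps_j or eps_i - eps_j with 5 >= i > j >= 1. *)
Definition k_root (R : realType) (alpha : 'rV[R]_8) : Prop :=
  exists i j : 'I_8, [/\ (j < i < 5)%N &
    alpha = eps R i + eps R j \/ alpha = eps R i - eps R j].

Inductive Wk (R : realType) : ('rV[R]_8 -> 'rV[R]_8) -> Prop :=
  | Wk_refl alpha : k_root alpha -> Wk (reflection alpha)
  | Wk_id : Wk id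
  | Wk_comp w1 w2 : Wk w1 -> Wk w2 -> Wk (w1 \o w2)
  | Wk_inv w w' : Wk w -> cancel w w' -> cancel w' w -> Wk w'.

Definition k_dominant (R : realType) (mu : 'rV[R]_8) : bool :=
  let x k := mu 0 (inord k) in
  [&& `|x 0%N| <= x 1%N, x 1%N <= x 2%N, x 2%N <= x 3%N & x 3%N <= x 4%N].

(* The k-dominant Wk-conjugate of mu, which exists and is unique; the default
   value 0 of xget is therefore never used. *)
Definition kplus (R : realType) (mu : 'rV[R]_8) : 'rV[R]_8 :=
  xget 0 [set nu | (exists2 w, Wk w & nu = w mu) /\ k_dominant nu]%classic.

Definition highest_weight (R : realType) (lam : 'rV[R]_8) : Prop :=
  [/\ k_dominant lam,
      lam 0 (inord 6) = lam 0 (inord 5),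
      lam 0 (inord 7) = - lam 0 (inord 5) &
      forall i j : 'I_8, (i < 5)%N -> (j < 5)%N ->
        lam 0 i - lam 0 j \is a Num.int /\ 2 * lam 0 i \is a Num.int].

Definition s1 (R : realType) : 'rV[R]_8 :=
  2^-1 *: vec8 [:: 1; 1; 1; 1; 1; -1; -1; 1].

Definition s2 (R : realType) : 'rV[R]_8 :=
  vec8 [:: 0; 0; 0; 0; 1; -1; -1; 1].

Definition schmid (R : realType) (a b : nat) : 'rV[R]_8 :=
  a%:R *: s1 R + b%:R *: s2 R.

(* The level of schmid a b; in particular s2 = schmid 0 1 has level 2. *)
Definition level (a b : nat) : nat := (a + 2 * b)%N.

Definition strict_dirac (R : realType) (lam s : 'rV[R]_8) : Prop :=
  enorm (kplus (lam - s) + rho R) ^+ 2 > enorm (lam + rho R) ^+ 2.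

Definition scalar_weight (R : realType) (l6 : R) : 'rV[R]_8 :=
  vec8 [:: 0; 0; 0; 0; 0; l6; l6; - l6].

Lemma scalar_weight_highest (R : realType) (l6 : R) :
  highest_weight (scalar_weight l6).
Proof.
have E (i : 'I_8) : (i < 5)%N -> scalar_weight l6 0 i = 0.
  by rewrite mxE; case: i => -[|[|[|[|[|]]]]].
split.
- by rewrite /k_dominant !E ?inordK // normr0 lexx.
- by rewrite !mxE !inordK.
- by rewrite !mxE !inordK.
- by move=> i j i5 j5; rewrite !E // subr0 mulr0.
Qed.

(* Main.v *)
Require Import Defs.
From mathcomp Require Import all_boot all_order all_algebra.
From mathcomp Require Import reals.
From mathcomp Require Import boolp classical_sets ring lra.

Import Order.TTheory GRing.Theory Num.Theory.
Set Implicit Arguments.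
Unset Strict Implicit.
Unset Printing Implicit Defensive.

Local Open Scope ring_scope.

(* The W_k-orbit of mu determines the squares of the first five coordinates (as
   a multiset), their product and the last three coordinates; these data
   determine a k-dominant vector. Hence the dominant conjugate of lambda - s_{a,b}
   is (-a/2, a/2, a/2, a/2, c, l6 + c, l6 + c, - l6 - c) with c = a/2 + b, and
   ||(lambda - s)^+ + rho||^2 - ||lambda + rho||^2
   = a^2 + 6 a + 4 c^2 - 16 c + 6 c l6. *)

Section DominantConjugate.
Variable R : realType.
Implicit Types (mu nu : 'rV[R]_8) (w : 'rV[R]_8 -> 'rV[R]_8).

Lemma dot_addl (u v w : 'rV[R]_8) : dot (u + v) w = dot u w + dot v w.
Proof. by rewrite -big_split; apply: eq_bigr => k _; rewrite mxE mulrDl. Qed.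

Lemma dot_scalel (a : R) (u w : 'rV[R]_8) : dot (a *: u) w = a * dot u w.
Proof. by rewrite /dot mulr_sumr; apply: eq_bigr => k _; rewrite mxE mulrA. Qed.

Lemma dotC (u v : 'rV[R]_8) : dot u v = dot v u.
Proof. by apply: eq_bigr => k _; rewrite mulrC. Qed.

Lemma dot_eps mu (i : 'I_8) : dot mu (eps R i) = mu 0 i.
Proof.
rewrite /dot (bigD1 i) //= big1 => [|k /negPf ki]; rewrite mxE eqxx.
  by rewrite eqxx mulr1 addr0.
by rewrite ki mulr0.
Qed.

(** The sign [e] treats both kinds of roots at once; the squared length [1 + e ^+ 2 = 2] cancels the
    factor 2 in [reflection]. *)
Lemma reflection_epsE (i j : 'I_8) (e : R) mu (k : 'I_8) :
  i != j -> e ^+ 2 = 1 ->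
  reflection (eps R i + e *: eps R j) mu 0 k =
    if k == i then - (e * mu 0 j) else if k == j then - (e * mu 0 i)
    else mu 0 k.
Proof.
move=> ij e1; rewrite /reflection.
have dotE nu : dot nu (eps R i + e *: eps R j) = nu 0 i + e * nu 0 j.
  by rewrite dotC dot_addl dot_scalel !(dotC (eps R _)) !dot_eps.
have ji : j != i by rewrite eq_sym.
rewrite !dotE !mxE !eqxx (negPf ij) (negPf ji) /=.
have -> : 1 + e * 0 + e * (0 + e * 1) = 2 :> R by rewrite mulr0 addr0 add0r mulr1 -expr2 e1.
rewrite [2 * _ / 2]mulrAC mulfV ?pnatr_eq0 // mul1r.
have [->|ki] := eqVneq k i.
  by rewrite (negPf ij) /=; ring.
have [->|kj] := eqVneq k j; last by rewrite /=; ring.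
rewrite /= mulr1 add0r mulrDl mulrAC -expr2 e1 mul1r; ring.
Qed.

Lemma k_rootP (alpha : 'rV[R]_8) : k_root alpha ->
  exists (i j : 'I_8) (e : R),
    [/\ (j < i < 5)%N, e = 1 \/ e = -1 & alpha = eps R i + e *: eps R j].
Proof.
move=> [i [j [ji [->|->]]]]; exists i, j.
  by exists 1; rewrite scale1r; split=> //; left.
by exists (-1); rewrite scaleN1r; split=> //; right.
Qed.

Lemma Wk_invariant (T : Type) (f : 'rV[R]_8 -> T) :
    (forall alpha, k_root alpha -> forall mu, f (reflection alpha mu) = f mu) ->
  forall w, Wk w -> forall mu, f (w mu) = f mu.
Proof.
move=> f_refl w; elim=> {w} [alpha /f_refl //|//|w1 w2 _ IH1 _ IH2 mu|].
  by rewrite /= IH1.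
(* Inverse: invariance under [w] is applied at the point [w' mu]. *)
by move=> w w' _ IH _ w'K mu; rewrite -IH w'K.
Qed.

(** A reflection moves only two coordinates: [e = -1] swaps them, [e = 1] swaps and negates both,
    which [hN] absorbs. A general [h] lets one argument yield both invariants, the squares and the
    product. *)
Lemma Wk_prod (S : comNzRingType) (h : R -> S) :
    (forall x y, h (- x) * h (- y) = h x * h y) ->
  forall w, Wk w -> forall mu,
  \prod_(k < 8 | (k < 5)%N) h (w mu 0 k) = \prod_(k < 8 | (k < 5)%N) h (mu 0 k).
Proof.
move=> hN; apply: (@Wk_invariant _
  (fun mu => \prod_(k < 8 | (k < 5)%N) h (mu 0 k))) => alpha.
move=> /k_rootP[i [j [e [/andP[lt_ji i5] e1 ->]]]] mu.
have j5 : (j < 5)%N := ltn_trans lt_ji i5.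
have ij : i != j by rewrite neq_ltn lt_ji orbT.
have ji : j != i by rewrite eq_sym.
have e2 : e ^+ 2 = 1 by case: e1 => ->; rewrite ?sqrrN expr1n.
rewrite (bigD1 i) // (bigD1 j) ?j5 //= [RHS](bigD1 i) // [in RHS](bigD1 j) ?j5 //=.
rewrite !mulrA; congr (_ * _); last first.
  apply: eq_bigr => k /andP[/andP[_ ki] kj].
  by rewrite reflection_epsE // (negPf ki) (negPf kj).
rewrite !reflection_epsE // !eqxx (negPf ji).
case: e1 => ->; first by rewrite !mul1r hN mulrC.
by rewrite !mulN1r !opprK mulrC.
Qed.

Lemma Wk_fix (k : 'I_8) : (5 <= k)%N -> forall w, Wk w -> forall mu,
  w mu 0 k = mu 0 k.
Proof.
move=> k5; apply: (@Wk_invariant _ (fun mu => mu 0 k)) => alpha.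
move=> /k_rootP[i [j [e [/andP[lt_ji i5] e1 ->]]]] mu.
have j5 : (j < 5)%N := ltn_trans lt_ji i5.
have e2 : e ^+ 2 = 1 by case: e1 => ->; rewrite ?sqrrN expr1n.
rewrite reflection_epsE // ?neq_ltn ?lt_ji ?orbT //.
by rewrite -!val_eqE !gtn_eqF // (leq_trans _ k5).
Qed.

Definition coord mu (k : nat) : R := mu 0 (inord k).

Lemma coord_inj mu nu :
  (forall k, (k < 8)%N -> coord mu k = coord nu k) -> mu = nu.
Proof. by move=> E; apply/rowP => k; rewrite -(inord_val k); apply: E. Qed.

Lemma prod_coord (S : comNzRingType) (h : R -> S) mu :
  \prod_(k < 8 | (k < 5)%N) h (mu 0 k) = \prod_(k <- iota 0 5) h (coord mu k).
Proof.
rewrite -[iota 0 5]/(index_iota 0 5) (big_nat_widen _ _ 8) // big_mkord.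
by apply: eq_big => [//|k _]; rewrite /coord inord_val.
Qed.

Definition squares mu := [seq coord mu k ^+ 2 | k <- iota 0 5].

Lemma Wk_squares w mu : Wk w -> perm_eq (squares (w mu)) (squares mu).
Proof.
(* A multiset is determined by the monic polynomial having it as roots, so it suffices that this
   polynomial is invariant. *)
move=> Ww; apply: prod_XsubC_eq; rewrite !big_map.
rewrite -2!(@prod_coord _ (fun x => 'X - (x ^+ 2)%:P)).
by apply: (@Wk_prod _ (fun x => 'X - (x ^+ 2)%:P)) => // x y; rewrite !sqrrN.
Qed.

(** This invariant records the parity of sign changes, which the squares lose. *)
Lemma Wk_prod_coord w mu : Wk w ->
  \prod_(k <- iota 0 5) coord (w mu) k = \prod_(k <- iota 0 5) coord mu k.
Proof.
move=> Ww; rewrite -2!(@prod_coord _ id).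
by apply: (@Wk_prod _ id) => // x y; rewrite mulrNN.
Qed.

Lemma k_dominantP mu : k_dominant mu ->
  [/\ `|coord mu 0| <= coord mu 1, coord mu 1 <= coord mu 2,
      coord mu 2 <= coord mu 3 & coord mu 3 <= coord mu 4].
Proof. by case/and4P. Qed.

Lemma sorted_squares mu : k_dominant mu -> sorted <=%R (squares mu).
Proof.
move=> /k_dominantP[m01 m12 m23 m34].
have m1 := le_trans (normr_ge0 _) m01.
have m2 := le_trans m1 m12; have m3 := le_trans m2 m23.
have m4 := le_trans m3 m34.
rewrite /= -[coord mu 0 ^+ 2]real_normK ?num_real //.
by rewrite !ler_pXn2r ?nnegrE ?normr_ge0 // m01 m12 m23 m34.
Qed.

(** Sorted permutations of each other are equal, so the squares agree entry by entry. Coordinates 1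
    to 4 are nonnegative, hence equal; the product then settles the sign of coordinate 0. *)
Lemma k_dominant_inj mu nu : k_dominant mu -> k_dominant nu ->
    perm_eq (squares mu) (squares nu) ->
    \prod_(k <- iota 0 5) coord mu k = \prod_(k <- iota 0 5) coord nu k ->
  forall k, (k < 5)%N -> coord mu k = coord nu k.
Proof.
move=> dmu dnu /(le_sorted_eq (sorted_squares dmu) (sorted_squares dnu)).
have [m01 m12 m23 m34] := k_dominantP dmu.
have [n01 n12 n23 n34] := k_dominantP dnu.
have m1 := le_trans (normr_ge0 _) m01.
have m2 := le_trans m1 m12; have m3 := le_trans m2 m23.
have m4 := le_trans m3 m34.
have n1 := le_trans (normr_ge0 _) n01.
have n2 := le_trans n1 n12; have n3 := le_trans n2 n23.
have n4 := le_trans n3 n34.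
have sqI (x y : R) : 0 <= x -> 0 <= y -> x ^+ 2 = y ^+ 2 -> x = y.
  by move=> x0 y0 /eqP; rewrite eqrXn2 // => /eqP.
case=> _ /sqI E1 /sqI E2 /sqI E3 /sqI E4.
move: {E1 E2 E3 E4} (E1 m1 n1) (E2 m2 n2) (E3 m3 n3) (E4 m4 n4) => E1 E2 E3 E4.
rewrite /= !big_cons !big_nil -E1 -E2 -E3 -E4 => Eprod.
suff E0 : coord mu 0 = coord nu 0 by do 5?[case=> //].
(* If coordinate 1 vanishes, dominance forces coordinate 0 to vanish; otherwise coordinates 1 to 4
   are positive and can be cancelled from the product. *)
move: m1; rewrite le_eqVlt => /predU1P[m1|m1].
  by move: m01 n01; rewrite -E1 -m1 !normr_le0 => /eqP-> /eqP->.
have m2' := lt_le_trans m1 m12; have m3' := lt_le_trans m2' m23.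
have m4' := lt_le_trans m3' m34.
by apply: mulIf Eprod; rewrite !mulf_neq0 ?oner_eq0 ?gt_eqF.
Qed.

(** Any other dominant conjugate shares all the invariants with [w mu], so [xget] has a single
    candidate. Exhibiting one [w] therefore computes [kplus]. *)
Lemma kplus_eq w mu : Wk w -> k_dominant (w mu) -> kplus mu = w mu.
Proof.
move=> Ww dom; apply: xget_unique.
  by split=> //; exists w.
move=> nu [[w' Ww' ->] dom']; apply: coord_inj => k k8.
have [k5|k5] := ltnP k 5; last by rewrite /coord !Wk_fix // inordK.
move: {k8} k k5; apply: k_dominant_inj => //; last by rewrite !Wk_prod_coord.
by rewrite (perm_trans (Wk_squares _ Ww')) // perm_sym Wk_squares.
Qed.

(** The two roots are orthogonal and span the plane of coordinates [i] and [j], so this product is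
    -1 on that plane: the basic even sign change. *)
Definition flip2 (i j : 'I_8) : 'rV[R]_8 -> 'rV[R]_8 :=
  reflection (eps R i - eps R j) \o reflection (eps R i + eps R j).

Lemma Wk_flip2 (i j : 'I_8) : (j < i < 5)%N -> Wk (flip2 i j).
Proof.
by move=> ij; apply: Wk_comp; apply: Wk_refl; exists i, j; split=> //;
  [right | left].
Qed.

Lemma flip2E (i j : 'I_8) mu (k : 'I_8) : i != j ->
  flip2 i j mu 0 k = if (k == i) || (k == j) then - mu 0 k else mu 0 k.
Proof.
move=> ij; have ji : j != i by rewrite eq_sym.
rewrite /flip2 /= -scaleN1r -[in eps R i + eps R j](scale1r (eps R j)).
rewrite !reflection_epsE ?sqrrN ?expr1n // !eqxx (negPf ji) !mulN1r !opprK !mul1r.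
have [->|ki] := eqVneq k i; first by [].
by have [->|kj] := eqVneq k j.
Qed.

Lemma kplus_scalar_sub_schmid (l6 : R) (a b : nat) :
  let h := a%:R / 2 in let c := h + b%:R in
  kplus (scalar_weight l6 - schmid R a b) =
    vec8 [:: - h; h; h; h; c; l6 + c; l6 + c; - (l6 + c)].
Proof.
move=> h c; set mu := _ - _.
pose w := flip2 (inord 4) (inord 3) \o flip2 (inord 2) (inord 1).
have Ww : Wk w by apply: Wk_comp; apply: Wk_flip2; rewrite !inordK.
have wE : w mu = vec8 [:: - h; h; h; h; c; l6 + c; l6 + c; - (l6 + c)].
  apply/rowP => k; rewrite /w /= !flip2E -?val_eqE /= ?inordK //.
  rewrite !mxE; case: k => -[|[|[|[|[|[|[|[|//]]]]]]]] k8 /=;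
    by rewrite /c /h; field.
rewrite -wE; apply: kplus_eq => //; rewrite wE /k_dominant !mxE !inordK //=.
have h0 : 0 <= h by rewrite divr_ge0 ?ler0n.
by rewrite normrN ger0_norm // !lexx lerDl ler0n.
Qed.

Lemma enorm_sqr mu : enorm mu ^+ 2 = dot mu mu.
Proof. by rewrite sqr_sqrtr // sumr_ge0 // => k _; rewrite -expr2 sqr_ge0. Qed.

Lemma dirac_scalar_schmid (l6 : R) (a b : nat) :
  let c := a%:R / 2 + b%:R in
  enorm (kplus (scalar_weight l6 - schmid R a b) + rho R) ^+ 2 =
  enorm (scalar_weight l6 + rho R) ^+ 2
    + (a%:R ^+ 2 + 6 * a%:R + 4 * c ^+ 2 - 16 * c + 6 * c * l6).
Proof.
rewrite /= kplus_scalar_sub_schmid !enorm_sqr /dot.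
by rewrite !big_ord_recl !big_ord0 !mxE /=; field.
Qed.

End DominantConjugate.

Theorem theorem2p1 (R : realType) (l6 : R) :
  [/\ (2 < l6 ->
        forall a b : nat, (a + b)%N <> 0%N ->
          strict_dirac (scalar_weight l6) (schmid R a b)),
      (0 < l6 -> l6 < 2 ->
        enorm (kplus (scalar_weight l6 - s2 R) + rho R) ^+ 2
          < enorm (scalar_weight l6 + rho R) ^+ 2
        /\
        forall a b : nat, (0 < a + b)%N -> (level a b < level 0 1)%N ->
          strict_dirac (scalar_weight l6) (schmid R a b))
    & (l6 < 0 ->
        enorm (kplus (scalar_weight l6 - s1 R) + rho R) ^+ 2
          < enorm (scalar_weight l6 + rho R) ^+ 2)].
Proof.
split.
- move=> l6_gt2 a b ab0; rewrite /strict_dirac dirac_scalar_schmid ltrDl.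
  have a0 : 0 <= a%:R :> R by exact: ler0n.
  have b0 : 0 <= b%:R :> R by exact: ler0n.
  (* With [c = a/2 + b], the difference is [6c(l6 - 2) + 2a^2 + 4a + 4ab + 4(b^2 - b)]. The first
     term is positive; the last is nonnegative because [b] is a natural number. *)
  have bb : b%:R <= b%:R ^+ 2 :> R.
    by rewrite -natrX ler_nat -mulnn; case: (b) => // n; rewrite leq_pmulr.
  have c_gt0 : 0 < a%:R / 2 + b%:R :> R.
    have : 1 <= a%:R + b%:R :> R by rewrite -natrD ler1n lt0n; exact/eqP.
    lra.
  have := mulr_gt0 c_gt0 (_ : 0 < l6 - 2); rewrite subr_gt0 => /(_ l6_gt2).
  have := mulr_ge0 a0 b0; have := mulr_ge0 a0 a0.
  nra.
- move=> l6_gt0 l6_lt2; split.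
    (* Here [c = 1] and the difference is [6(l6 - 2)]. *)
    have -> : s2 R = schmid R 0 1 by rewrite /schmid scale0r scale1r add0r.
    by rewrite dirac_scalar_schmid gtrDl; lra.
  (* Level below 2 leaves only [a = 1], [b = 0], where the difference is [3 * l6]. *)
  move=> [|[|a]] [|b] //; rewrite /level ?mulnS ?addnS // => _ _.
  by rewrite /strict_dirac dirac_scalar_schmid ltrDl; lra.
- move=> l6_lt0.
  (* The difference is again [3 * l6], now negative. *)
  have -> : s1 R = schmid R 1 0 by rewrite /schmid scale0r scale1r addr0.
  by rewrite dirac_scalar_schmid gtrDl; lra.
Qed.
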